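(* For all integers $m \ge n \ge 1$, $$\gamma_c(G(n,m)) = \begin{cases} \left\lceil \dfrac{m}{2} \right\rceil + 1, & \text{if } n=2 \text{ and } m \text{ is odd},\\[0.6em] \left\lfloor \dfrac{m}{2} \right\rfloor + 1, & \text{otherwise}.\end{cases}$$
   Context: For integers $n,m\ge 1$, the grid $G(n,m)$ has cell set $V_{n,m}=\{(i,j): 1\le i\le n,\ 1\le j\le m\}$ ($i$ = row, $j$ = column). Contamination rules: a cell $u=(i,j)\in V_{n,m}$ can be contaminated by two contaminated cells $v,w\in V_{n,m}$ if one of the following holds: (a) $v=(i-1,j-1)$, $w=(i+1,j+1)$; (b) $v=(i+1,j-1)$, $w=(i-1,j+1)$; (c) $v=(i-1,j)$, $w=(i+1,j)$; (d) $v=(i,j-1)$, $w=(i,j+1)$; (e) $v=(i,j-1)$, $w=(i-1,j)$; (f) $v=(i,j-1)$, $w=(i+1,j)$; (g) $v=(i+1,j)$, $w=(i,j+1)$; (h) $v=(i-1,j)$, $w=(i,j+1)$. For $S\subseteq V_{n,m}$, the final contaminated set $C(S)$ is obtained by starting from $S$ and repeatedly adding cells that can be contaminated by two already contaminated cells, until no more can be added; equivalently, $C(S)$ is the smallest subset of $V_{n,m}$ containing $S$ and closed under rules (a)--(h). $S$ is a contaminating set (it fully contaminates the grid) if $C(S)=V_{n,m}$. The power contamination number $\gamma_c(G(n,m))$ is the minimum cardinality of a contaminating set. *)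

(* Defs.v *)
From mathcomp Require Import all_boot.

Set Implicit Arguments.
Unset Strict Implicit.
Unset Printing Implicit Defensive.

(* Cell (i, j), 1 <= i <= n and 1 <= j <= m, of G(n,m) is encoded by the pair
   of ordinals with values (i - 1, j - 1); the contamination rules only involve
   relative positions. *)
Definition cell (n m : nat) : predArgType := ('I_n * 'I_m)%type.

(* A coordinate i - 1 of v is expressed as v.1.+1 == i, since subtraction on nat
   is truncated. *)
Definition contaminated_by (n m : nat) (u v w : cell n m) : bool :=
  let i : nat := u.1 in let j : nat := u.2 in
  let vi : nat := v.1 in let vj : nat := v.2 in
  let wi : nat := w.1 in let wj : nat := w.2 in
  [|| (* v = (i-1, j-1), w = (i+1, j+1) *)
      [&& vi.+1 == i, vj.+1 == j, wi == i.+1 & wj == j.+1],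
      (* v = (i+1, j-1), w = (i-1, j+1) *)
      [&& vi == i.+1, vj.+1 == j, wi.+1 == i & wj == j.+1],
      (* v = (i-1, j), w = (i+1, j) *)
      [&& vi.+1 == i, vj == j, wi == i.+1 & wj == j],
      (* v = (i, j-1), w = (i, j+1) *)
      [&& vi == i, vj.+1 == j, wi == i & wj == j.+1],
      (* v = (i, j-1), w = (i-1, j) *)
      [&& vi == i, vj.+1 == j, wi.+1 == i & wj == j],
      (* v = (i, j-1), w = (i+1, j) *)
      [&& vi == i, vj.+1 == j, wi == i.+1 & wj == j],
      (* v = (i+1, j), w = (i, j+1) *)
      [&& vi == i.+1, vj == j, wi == i & wj == j.+1]
    | (* v = (i-1, j), w = (i, j+1) *)
      [&& vi.+1 == i, vj == j, wi == i & wj == j.+1]].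

Definition contaminable (n m : nat) (A : {set cell n m}) : {set cell n m} :=
  [set u | [exists v in A, exists w in A, contaminated_by u v w]].

(* Iterating A |-> S :|: contaminable A from set0 gives S after one step, then
   adds at each step every cell contaminable by two cells already present. *)
Definition final_set (n m : nat) (S : {set cell n m}) : {set cell n m} :=
  fixset (fun A => S :|: contaminable A).

Definition contaminating (n m : nat) (S : {set cell n m}) : bool :=
  final_set S == [set: cell n m].

(* The minimum is well defined by contaminatingT below. *)
Definition power_contamination_number (n m : nat) : nat :=
  #|[arg min_(S < [set: cell n m] | contaminating S) #|S|]|.

Lemma contaminableS (n m : nat) (A B : {set cell n m}) :
  A \subset B -> contaminable A \subset contaminable B.
Proof.
move=> /subsetP sAB; apply/subsetP=> u; rewrite !inE.
case/exists_inP=> v vA /exists_inP[w wA uvw].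
by apply/exists_inP; exists v; [exact: sAB | apply/exists_inP; exists w => //; exact: sAB].
Qed.

Lemma final_setE (n m : nat) (S : {set cell n m}) :
  S :|: contaminable (final_set S) = final_set S.
Proof.
by apply: (@fixsetK _ (fun A => S :|: contaminable A)) => A B /contaminableS; exact: setUS.
Qed.

(* final_set S is the least set containing S and closed under the rules. *)
Lemma final_set_least (n m : nat) (S : {set cell n m}) :
  [/\ S \subset final_set S,
      contaminable (final_set S) \subset final_set S
    & forall A : {set cell n m}, S \subset A -> contaminable A \subset A -> final_set S \subset A].
Proof.
split; first by rewrite -final_setE subsetUl.
  by rewrite -{2}final_setE subsetUr.
move=> A sSA cA; rewrite /final_set /fixset; elim: #|_| => [|k IHk] /=.
  exact: sub0set.
by rewrite subUset sSA (subset_trans (contaminableS IHk)).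
Qed.

Lemma contaminatingT (n m : nat) : contaminating [set: cell n m].
Proof. by rewrite /contaminating -subTset; case: (final_set_least [set: cell n m]). Qed.

Lemma power_contamination_number_min (n m : nat) :
  (exists2 S : {set cell n m},
     contaminating S & #|S| = power_contamination_number n m)
  /\ (forall S : {set cell n m},
        contaminating S -> power_contamination_number n m <= #|S|).
Proof.
rewrite /power_contamination_number.
case: arg_minnP; first exact: contaminatingT.
by move=> S cS minS; split; first exists S.
Qed.

(* Main.v *)
(** For the lower bound, cut the columns (numbered from 0) into the classes
    [{0}], [{1, 2}], [{3, 4}], ...: every rule that adds a cell uses either a
    cell of the same column or one cell in each of the two adjacent columns, and
    one of these lies in the same class.  Hence a class without initial cells
    stays uncontaminated, and each of the [m./2 + 1] classes meets a
    contaminating set [S].  For odd [m] the classes [{0, 1}], [{2, 3}], ...,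
    [{m - 1}] may be used as well.  If [S] has only [m./2 + 1] cells, it then
    has one cell in every class of both kinds, so that its cells are pairwise
    at column distance at least 2.  In two rows, contamination then stops after
    filling the horizontal gaps of length one, and column 0 is not filled.

    For the upper bound, a contaminated [a x b] rectangle in the corner of the
    grid grows to [a x (b + 2)], [(a + 1) x (b + 1)], [(a + 2) x (b + 2)] or (if
    [2 <= a]) [(a + 1) x (b + 2)] when one suitable cell is added.  Start along
    the diagonal and continue along the rows; the last kind of growth saves one
    cell when [n >= 4] is even and [m] is odd. *)

Require Import Defs.
From mathcomp Require Import all_boot zify.

Set Implicit Arguments.
Unset Strict Implicit.
Unset Printing Implicit Defensive.

(** * Closed sets of cells *)

Section Closure.

Variables n m : nat.
Implicit Types S A : {set cell n m}.

Lemma contaminating_sub S A :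
  contaminating S -> S \subset A -> contaminable A \subset A -> A = setT.
Proof.
move=> /eqP cS sSA cA; apply/eqP; rewrite -subTset -cS.
by case: (final_set_least S) => _ _; apply.
Qed.

Lemma contaminable_subP A :
  reflect (forall u v w, v \in A -> w \in A -> contaminated_by u v w -> u \in A)
          (contaminable A \subset A).
Proof.
apply: (iffP subsetP) => [cA u v w vA wA uvw | cA u].
  by apply: cA; rewrite inE; apply/exists_inP; exists v => //;
     apply/exists_inP; exists w.
by rewrite inE => /exists_inP[v vA /exists_inP[w wA]]; apply: cA.
Qed.

End Closure.

(** * Lower bound by column classes *)

Lemma half_step i : i.+1./2 = i./2 \/ i.+1./2 = i.+2./2.
Proof. lia. Qed.

Lemma uphalf_step i : uphalf i.+1 = uphalf i \/ uphalf i.+1 = uphalf i.+2.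
Proof. lia. Qed.

(** The cuts given by [half] and [uphalf] are offset by one column, so no two neighbouring columns
    are separated by both. *)
Lemma near_class i j :
  i = j \/ i = j.+1 \/ j = i.+1 -> i./2 = j./2 \/ uphalf i = uphalf j.
Proof. lia. Qed.

Section LowerBound.

Variables n m : nat.
Hypothesis n_gt0 : 0 < n.

Lemma column_class_hit (g : nat -> nat) (S : {set cell n m}) (j : nat) :
    (forall i, g i.+1 = g i \/ g i.+1 = g i.+2) -> contaminating S -> j < m ->
  exists2 u, u \in S & g u.2 = g j.
Proof.
move=> g_step cS j_m; case: (boolP [exists u : cell n m in S, g u.2 == g j]) => [|hN].
  by case/exists_inP=> u uS /eqP gu; exists u.
pose A := [set u : cell n m | g u.2 != g j].
have SA : S \subset A.
  apply/subsetP => u uS; rewrite inE; apply: contra hN => gu.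
  by apply/exists_inP; exists u.
have cA : contaminable A \subset A.
  apply/contaminable_subP => -[ui uj] [vi vj] [wi wj].
  rewrite !inE /contaminated_by /= => gv gw uvw.
  (* The three rules that use no cell in the column of [u] use both adjacent columns. *)
  have [uv | [uw | [uv wu]]] :
      uj = vj :> nat \/ uj = wj :> nat \/ uj = vj.+1 :> nat /\ wj = uj.+1 :> nat.
  - by move: uvw; do ![case/orP]; case/and4P; lia.
  - by rewrite uv.
  - by rewrite uw.
  by rewrite uv; case: (g_step vj) => ->; rewrite // -uv -wu.
have /setP/(_ (Ordinal n_gt0, Ordinal j_m)) := contaminating_sub cS SA cA.
by rewrite !inE eqxx.
Qed.

Lemma class_imset (g : nat -> nat) (S : {set cell n m}) :
    (forall k, k <= m./2 -> exists2 u, u \in S & g u.2 = k) ->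
  [set (inord (g u.2) : 'I_(m./2).+1) | u : cell n m in S] = setT.
Proof.
move=> hit; apply/setP => k; rewrite inE; apply/imsetP.
have [|u uS gu] := hit k; first by rewrite -ltnS ltn_ord.
by exists u; rewrite // gu inord_val.
Qed.

Lemma uphalf_hit (S : {set cell n m}) (k : nat) :
  0 < m -> contaminating S -> k <= m./2 -> exists2 u, u \in S & uphalf u.2 = k.
Proof.
(* [k.*2.-1] is the first column of class [k]; truncation gives column 0 for [k = 0]. *)
move=> m_gt0 cS k_m; have [|u uS gu] := column_class_hit (j := k.*2.-1) uphalf_step cS.
  by lia.
by exists u => //; lia.
Qed.

(** For odd [m] the last column is [(m./2).*2], so class [m./2] is not empty. *)
Lemma half_hit (S : {set cell n m}) (k : nat) :
  odd m -> contaminating S -> k <= m./2 -> exists2 u, u \in S & u.2./2 = k.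
Proof.
move=> m_odd cS k_m; have [|u uS gu] := column_class_hit (j := k.*2) half_step cS.
  by lia.
by exists u => //; lia.
Qed.

Lemma contaminating_card (S : {set cell n m}) :
  0 < m -> contaminating S -> m./2 < #|S|.
Proof.
move=> m_gt0 cS; have /(congr1 (fun A : {set _} => #|A|)) :=
  class_imset (fun k => @uphalf_hit S k m_gt0 cS).
by rewrite cardsT card_ord => <-; apply: leq_imset_card.
Qed.

(** A surjection onto a finite set at least as large as its domain is injective. *)
Lemma class_inj (g : nat -> nat) (S : {set cell n m}) :
    (forall k, k <= m./2 -> exists2 u, u \in S & g u.2 = k) ->
    #|S| <= (m./2).+1 ->
  {in S &, forall u v : cell n m, g u.2 = g v.2 -> u = v}.
Proof.
move=> hit S_le u v uS vS guv.
have gS := class_imset hit.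
have /imset_injP g_inj : #|[set (inord (g u.2) : 'I_(m./2).+1) | u : cell n m in S]| == #|S|.
  by rewrite eqn_leq leq_imset_card gS cardsT card_ord.
by apply: g_inj; rewrite // guv.
Qed.

End LowerBound.

(** * Two rows and an odd number of columns *)

Lemma contaminating_card2 m (S : {set cell 2 m}) :
  odd m -> contaminating S -> uphalf m < #|S|.
Proof.
move=> m_odd cS; have m_gt0 : 0 < m by case: m m_odd {S cS}.
rewrite ltnNge; apply/negP; rewrite uphalf_half m_odd add1n => S_le.
have inj_h := class_inj (fun k => @half_hit 2 m isT S k m_odd cS) S_le.
have inj_u := class_inj (fun k => @uphalf_hit 2 m isT S k m_gt0 cS) S_le.
have far : {in S &, forall u v : cell 2 m,
    u.2 = v.2 :> nat \/ u.2 = v.2.+1 :> nat \/ v.2 = u.2.+1 :> nat -> u = v}.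
  move=> u v uS vS uv.
  case: (near_class uv); first exact: inj_h.
  exact: inj_u.
pose gap (u v w : cell 2 m) :=
  [&& v.1 == u.1, w.1 == u.1, v.2.+1 == u.2 & w.2 == u.2.+1 :> nat].
(* [S] with its horizontal gaps of length one filled: the candidate for a closed proper subset. *)
pose A := [set u | (u \in S) || [exists v in S, exists w in S, gap u v w]].
have gapP u v w : gap u v w ->
    [/\ v.1 = u.1 :> nat, w.1 = u.1 :> nat, v.2.+1 = u.2 :> nat & w.2 = u.2.+1 :> nat].
  by case/and4P=> /eqP-> /eqP-> /eqP-> /eqP->.
have AP u : u \in A -> u \in S \/ exists v w, [/\ v \in S, w \in S & gap u v w].
  rewrite inE => /orP[|/exists_inP[v vS /exists_inP[w wS g]]]; first by left.
  by right; exists v, w.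
have SA u : u \in S -> u \in A by rewrite inE => ->.
have cell_eq (u v : cell 2 m) : u.1 = v.1 :> nat -> u.2 = v.2 :> nat -> u = v.
  by case: u v => [ui uj] [vi vj] /= ? ?; congr (_, _); apply: val_inj.
(* A cell of [A] outside [S] has both its row neighbours in [S]. *)
have leftA (u v : cell 2 m) : v \in A -> v.1 = u.1 :> nat -> v.2.+1 = u.2 :> nat ->
    u \in S \/ v \in S.
  move=> /AP[|[x [y [xS yS /gapP[x1 y1 x2 y2]]]]] v1 v2; [by right | left].
  by rewrite (cell_eq u y) // ?y1 ?y2 ?v1 ?v2.
have rightA (u w : cell 2 m) : w \in A -> w.1 = u.1 :> nat -> w.2 = u.2.+1 :> nat ->
    u \in S \/ w \in S.
  move=> /AP[|[x [y [xS yS /gapP[x1 y1 x2 y2]]]]] w1 w2; [by right | left].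
  by rewrite (cell_eq u x) // ?x1 ?w1 //; apply: succn_inj; rewrite x2 w2.
(* If [w] is in [S], it is one column away from [v]; if it fills a gap, one end of the gap shares
   the column of [v]. Both contradict [far], as the rows differ. *)
have corner (u v w : cell 2 m) : v \in S -> w \in A -> v.1 = u.1 :> nat ->
    v.2.+1 = u.2 :> nat \/ v.2 = u.2.+1 :> nat -> w.1 <> u.1 :> nat ->
    w.2 = u.2 :> nat -> False.
  move=> vS /AP[wS | [x [y [xS yS /gapP[x1 y1 x2 y2]]]]] v1 v2 w1 w2.
    suff vw : v = w by apply: w1; rewrite -vw.
    by apply: far => //; rewrite w2; case: v2 => ->; auto.
  case: v2 => v2.
    suff vx : v = x by apply: w1; rewrite -x1 -vx.
    by apply: far => //; left; apply: succn_inj; rewrite v2 x2.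
  suff vy : v = y by apply: w1; rewrite -y1 -vy.
  by apply: far => //; left; rewrite v2 y2 w2.
have cA : contaminable A \subset A.
  apply/contaminable_subP => -[ui uj] [vi vj] [wi wj] vA wA.
  have [ui2 vi2 wi2] : [/\ ui < 2, vi < 2 & wi < 2] by rewrite !ltn_ord.
  rewrite /contaminated_by /= => uvw.
  (* Two rows exclude the rules using the rows on both sides of [u]; the horizontal rule and the
     corners with a left or a right cell remain. *)
  have [[e1 [e2 [e3 e4]]] | [[e1 [e2 [e3 e4]]] | [e1 [e2 [e3 e4]]]]] :
         (vi = ui :> nat /\ vj.+1 = uj :> nat /\ wi = ui :> nat /\ wj = uj.+1 :> nat)
      \/ (vi = ui :> nat /\ vj.+1 = uj :> nat /\ wi <> ui :> nat /\ wj = uj :> nat)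
      \/ (wi = ui :> nat /\ wj = uj.+1 :> nat /\ vi <> ui :> nat /\ vj = uj :> nat).
  - by move: uvw; do ![case/orP]; case/and4P; lia.
  - have [uS | vS] := leftA (ui, uj) _ vA e1 e2; first exact: SA.
    have [uS | wS] := rightA (ui, uj) _ wA e3 e4; first exact: SA.
    rewrite inE; apply/orP; right.
    apply/exists_inP; exists (vi, vj) => //; apply/exists_inP; exists (wi, wj) => //.
    by apply/and4P; split; apply/eqP => //; apply: val_inj.
  - have [uS | vS] := leftA (ui, uj) _ vA e1 e2; first exact: SA.
    by case: (corner (ui, uj) _ _ vS wA e1 (or_introl e2) e3 e4).
  - have [uS | wS] := rightA (ui, uj) _ wA e1 e2; first exact: SA.
    by case: (corner (ui, uj) _ _ wS vA e1 (or_intror e2) e3 e4).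
have AT : A = setT by apply: contaminating_sub cS _ cA; apply/subsetP.
(* A cell of column 0 has no left neighbour, hence fills no gap. *)
have col0 (i : 'I_2) : (i, Ordinal m_gt0) \in S.
  have /AP[//|[x [y [_ _]]]] : (i, Ordinal m_gt0) \in A by rewrite AT inE.
  by case/and4P.
by have [] := far _ _ (col0 ord0) (col0 ord_max) (or_introl erefl).
Qed.

(** * Upper bound by growing a corner rectangle *)

Section UpperBound.

Variables n m : nat.
Implicit Types S A : {set cell n m}.

(** Positions are natural numbers, false off the grid, so that index shifts need no ordinal
    bounds. *)
Definition occupied A (i j : nat) : bool :=
  [exists u : cell n m in A, (u.1 == i :> nat) && (u.2 == j :> nat)].

Lemma occupiedP A i j :
  reflect (exists2 u, u \in A & u.1 = i :> nat /\ u.2 = j :> nat) (occupied A i j).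
Proof.
apply: (iffP exists_inP) => [[u uA /andP[/eqP ? /eqP ?]] | [[ui uj] uA /= [<- <-]]].
  by exists u.
by exists (ui, uj); rewrite //= !eqxx.
Qed.

Definition full_block A (a b : nat) : Prop :=
  forall i j, i < a -> j < b -> occupied A i j.

Section ClosedSet.

Variable A : {set cell n m}.
Hypothesis cA : contaminable A \subset A.

Lemma occupied_mid_row i j :
  occupied A i j -> occupied A i j.+2 -> occupied A i j.+1.
Proof.
move=> /occupiedP[[vi vj] vA /= [ei ej]] /occupiedP[[wi wj] wA /= [fi fj]].
have j_m : j.+1 < m by rewrite ltnW // -fj.
apply/occupiedP; exists (vi, Ordinal j_m); last by split.
by apply: (contaminable_subP _ cA) vA wA _;
   rewrite /contaminated_by /= ?ei ?ej ?fi ?fj !eqxx ?orbT.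
Qed.

Lemma occupied_mid_diag i j :
  occupied A i j -> occupied A i.+2 j.+2 -> occupied A i.+1 j.+1.
Proof.
move=> /occupiedP[[vi vj] vA /= [ei ej]] /occupiedP[[wi wj] wA /= [fi fj]].
have i_n : i.+1 < n by rewrite ltnW // -fi.
have j_m : j.+1 < m by rewrite ltnW // -fj.
apply/occupiedP; exists (Ordinal i_n, Ordinal j_m); last by split.
by apply: (contaminable_subP _ cA) vA wA _;
   rewrite /contaminated_by /= ?ei ?ej ?fi ?fj !eqxx ?orbT.
Qed.

Lemma occupied_diag i j :
  occupied A i j -> occupied A i.+1 j.+1 -> occupied A i j.+1 /\ occupied A i.+1 j.
Proof.
move=> /occupiedP[[vi vj] vA /= [ei ej]] /occupiedP[[wi wj] wA /= [fi fj]]; split; apply/occupiedP.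
  exists (vi, wj); last by split.
  by apply: (contaminable_subP _ cA) vA wA _;
   rewrite /contaminated_by /= ?ei ?ej ?fi ?fj !eqxx ?orbT.
exists (wi, vj); last by split.
by apply: (contaminable_subP _ cA) vA wA _;
   rewrite /contaminated_by /= ?ei ?ej ?fi ?fj !eqxx ?orbT.
Qed.

Lemma occupied_antidiag i j :
  occupied A i.+1 j -> occupied A i j.+1 -> occupied A i j /\ occupied A i.+1 j.+1.
Proof.
move=> /occupiedP[[vi vj] vA /= [ei ej]] /occupiedP[[wi wj] wA /= [fi fj]]; split; apply/occupiedP.
  exists (wi, vj); last by split.
  by apply: (contaminable_subP _ cA) vA wA _;
   rewrite /contaminated_by /= ?ei ?ej ?fi ?fj !eqxx ?orbT.
exists (vi, wj); last by split.
by apply: (contaminable_subP _ cA) vA wA _;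
   rewrite /contaminated_by /= ?ei ?ej ?fi ?fj !eqxx ?orbT.
Qed.

(** Used along a new row or column, which fills in both directions from one occupied cell. *)
Lemma spread (Q : nat -> Prop) (a i k : nat) :
  (forall l, l.+1 < a -> Q l <-> Q l.+1) -> i < a -> k < a -> Q i -> Q k.
Proof.
move=> Q_step; have Q0 l : l < a -> Q 0 <-> Q l.
  by elim: l => // l IHl l_a; rewrite -(Q_step l l_a); apply/IHl/ltnW.
by move=> i_a k_a /(Q0 i i_a)/(Q0 k k_a).
Qed.

Lemma full_block_col a b i :
  0 < b -> full_block A a b -> i < a -> occupied A i b -> full_block A a b.+1.
Proof.
case: b => // b _ fA i_a ib k j k_a; rewrite ltnS leq_eqVlt => /orP[/eqP->|]; last exact: fA.
apply: (spread (Q := fun l => occupied A l b.+1)) i_a k_a ib => l l_a; split=> occ.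
  by have [] // := @occupied_antidiag l b; apply: fA.
by have [] // := @occupied_diag l b; apply: fA => //; apply: ltnW.
Qed.

Lemma full_block_row a b j :
  0 < a -> full_block A a b -> j < b -> occupied A a j -> full_block A a.+1 b.
Proof.
case: a => // a _ fA j_b aj i k; rewrite ltnS leq_eqVlt => /orP[/eqP->|] k_b; last exact: fA.
apply: (spread (Q := fun l => occupied A a.+1 l)) j_b k_b aj => l l_b; split=> occ.
  by have [] // := @occupied_antidiag a l; apply: fA.
by have [] // := @occupied_diag a l; apply: fA => //; apply: ltnW.
Qed.

(** With the last cell of the block, the new cell contaminates a cell of the next column; once that
    column is full, the new cell lies just below the block. *)
Lemma full_block_corner a b :
  0 < a -> 0 < b -> full_block A a b -> occupied A a b -> full_block A a.+1 b.+1.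
Proof.
case: a b => [//|a] [//|b] _ _ fA ab.
have [ab' _] := occupied_diag (fA a b (leqnn _) (leqnn _)) ab.
apply: (full_block_row (j := b.+1)) ab => //.
exact: (full_block_col (i := a)).
Qed.

Lemma full_block_diag a b :
  0 < a -> 0 < b -> full_block A a b -> occupied A a.+1 b.+1 -> full_block A a.+2 b.+2.
Proof.
case: a b => [//|a] [//|b] _ _ fA ab.
have ab' := occupied_mid_diag (fA a b (leqnn _) (leqnn _)) ab.
by do 2![apply: full_block_corner => //].
Qed.

Lemma full_block_col2 a b :
  0 < a -> 0 < b -> full_block A a b -> occupied A 0 b.+1 -> full_block A a b.+2.
Proof.
case: b => [//|b] a_gt0 _ fA ab.
have ab' := occupied_mid_row (fA 0 b a_gt0 (leqnn _)) ab.
by do 2![apply: (full_block_col (i := 0)) => //].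
Qed.

(** The midpoint of the new cell and the block cell two rows up, two columns left, starts the next
    column; the new cell is then at the corner. Row [a - 2] must exist. *)
Lemma full_block_knight a b :
  1 < a -> 0 < b -> full_block A a b -> occupied A a b.+1 -> full_block A a.+1 b.+2.
Proof.
case: a b => [//|[//|a]] [//|b] _ _ fA ab.
have ab' := occupied_mid_diag (fA a b (leqnSn _) (leqnn _)) ab.
by apply: full_block_corner => //; apply: (full_block_col (i := a.+1)).
Qed.

End ClosedSet.

(** A bound on [#|S|], not an equality, allows adding a cell without checking that it is new. *)
Definition fills (k a b : nat) : Prop :=
  exists2 S : {set cell n m}, #|S| <= k &
    forall A : {set cell n m}, S \subset A -> contaminable A \subset A -> full_block A a b.

Lemma fills_add k a b p q a' b' :
    p < n -> q < m ->
    (forall A, contaminable A \subset A -> full_block A a b -> occupied A p q ->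
       full_block A a' b') ->
  fills k a b -> fills k.+1 a' b'.
Proof.
move=> p_n q_m grow [S S_k fS]; exists ((Ordinal p_n, Ordinal q_m) |: S).
  by rewrite cardsU1 -add1n leq_add // leq_b1.
move=> A; rewrite subUset sub1set => /andP[pqA sSA] cA.
by apply: grow (fS A sSA cA) _ => //; apply/occupiedP; exists (Ordinal p_n, Ordinal q_m).
Qed.

Lemma fills00 : fills 0 0 0.
Proof. by exists set0; rewrite ?cards0. Qed.

(** The diagonal cells (0, 0), (2, 2), ..., (2h, 2h) suffice. *)
Lemma fills_odd_square h : h.*2 < n -> h.*2 < m -> fills h.+1 h.*2.+1 h.*2.+1.
Proof.
elim: h => [|h IHh] h_n h_m.
  apply: (fills_add h_n h_m) fills00 => A cA _ A00.
  by case=> [|//] [|//].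
apply: (fills_add h_n h_m) (IHh _ _); [|lia..].
by move=> A cA fA occ; apply: full_block_diag.
Qed.

Lemma fills_cols k a b h :
  0 < a <= n -> 0 < b -> b + h.*2 <= m -> fills k a b -> fills (k + h) a (b + h.*2).
Proof.
case/andP=> a_gt0 a_n b_gt0 b_m kab; elim: h b_m => [|h IHh] b_m.
  by rewrite !addn0.
have IH : fills (k + h) a (b + h.*2) by apply: IHh; lia.
have n_gt0 : 0 < n by lia.
have q_m : (b + h.*2).+1 < m by lia.
rewrite addnS doubleS !addnS.
apply: (fills_add n_gt0 q_m) IH => A cA fA occ.
by apply: full_block_col2 => //; lia.
Qed.

Lemma fills_col k a b : 0 < a <= n -> 0 < b < m -> fills k a b -> fills k.+1 a b.+1.
Proof.
case/andP=> a_gt0 a_n /andP[b_gt0 b_m].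
apply: (fills_add (leq_trans a_gt0 a_n) b_m) => A cA fA.
exact: full_block_col.
Qed.

Lemma fills_corner k a b : 0 < a < n -> 0 < b < m -> fills k a b -> fills k.+1 a.+1 b.+1.
Proof.
case/andP=> a_gt0 a_n /andP[b_gt0 b_m].
by apply: (fills_add a_n b_m) => A cA fA; apply: full_block_corner.
Qed.

Lemma fills_knight k a b : 1 < a < n -> 0 < b -> b.+1 < m -> fills k a b -> fills k.+1 a.+1 b.+2.
Proof.
case/andP=> a_gt1 a_n b_gt0 b_m.
by apply: (fills_add a_n b_m) => A cA fA; apply: full_block_knight.
Qed.

Lemma fills_number k : fills k n m -> power_contamination_number n m <= k.
Proof.
case=> S S_k fS; apply: leq_trans S_k.
apply: (power_contamination_number_min n m).2.
apply/eqP/setP => u; rewrite inE; have [sS cS _] := final_set_least S.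
have /occupiedP[v vS [v1 v2]] := fS _ sS cS _ _ (ltn_ord u.1) (ltn_ord u.2).
suff -> : u = v by [].
by case: u v v1 v2 {vS} => [ui uj] [vi vj] /= ? ?; congr (_, _); apply/val_inj.
Qed.

Lemma fills_all :
  1 <= n -> n <= m -> fills (if (n == 2) && odd m then uphalf m + 1 else m./2 + 1) n m.
Proof.
move=> n_gt0 n_m.
have wide k b : 0 < b -> b <= m -> ~~ odd (m - b) -> fills k n b -> fills (k + (m - b)./2) n m.
  move=> b_gt0 b_m ev kb.
  have E : b + ((m - b)./2).*2 = m by lia.
  by rewrite -{2}E; apply: fills_cols => //; lia.
(* The side is [n] for odd [n] and [n.-1] for even [n]. *)
have sq : fills (n.-1./2).+1 (n.-1./2).*2.+1 (n.-1./2).*2.+1.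
  by apply: fills_odd_square; lia.
case: (boolP (odd n)) => n_odd.
  have E : (n.-1./2).*2.+1 = n by lia.
  rewrite E in sq.
  case: (boolP (odd m)) => m_odd.
    have := wide _ _ n_gt0 n_m _ sq.
    by case: ifP => [|_]; [lia | move=> /(_ ltac:(lia)); congr fills; lia].
  have n_m' : n < m by lia.
  have sq' : fills (n.-1./2).+2 n n.+1 by apply: fills_col sq; lia.
  have := wide _ n.+1 isT n_m' _ sq'.
  by case: ifP => [|_]; [lia | move=> /(_ ltac:(lia)); congr fills; lia].
have E : (n.-1./2).*2.+1 = n.-1 by lia.
rewrite E in sq.
have sq' : fills (n.-1./2).+2 n n.
  have -> : fills (n.-1./2).+2 n n = fills (n.-1./2).+2 n.-1.+1 n.-1.+1 by congr fills; lia.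
  by apply: fills_corner sq; lia.
case: (boolP (odd m)) => m_odd; last first.
  have := wide _ _ n_gt0 n_m _ sq'.
  by case: ifP => [|_]; [lia | move=> /(_ ltac:(lia)); congr fills; lia].
have n_m' : n < m by lia.
(* For [n = 2] the square has a single row, too few for [fills_knight]: a corner cell and a column
   cell are both spent. *)
case: ifP => n2.
  have sq2 : fills (n.-1./2).+3 n n.+1 by apply: fills_col sq'; lia.
  have := wide _ n.+1 isT n_m' _ sq2.
  by move=> /(_ ltac:(lia)); congr fills; lia.
have sq2 : fills (n.-1./2).+2 n n.+1.
  have -> : fills (n.-1./2).+2 n n.+1 = fills (n.-1./2).+2 n.-1.+1 n.-1.+2 by congr fills; lia.
  by apply: fills_knight sq; lia.
have := wide _ n.+1 isT n_m' _ sq2.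
by move=> /(_ ltac:(lia)); congr fills; lia.
Qed.

End UpperBound.

Theorem theorem1 :
  forall n m : nat, 1 <= n -> n <= m ->
    power_contamination_number n m =
      if (n == 2) && odd m then uphalf m + 1 else m./2 + 1.
Proof.
move=> n m n_gt0 n_m; apply/eqP; rewrite eqn_leq (fills_number (fills_all n_gt0 n_m)) /=.
have [[S cS <-] _] := power_contamination_number_min n m.
rewrite (fun_if (fun x => x <= _)) !addn1 contaminating_card ?(leq_trans n_gt0) //.
case: ifP => // /andP[/eqP n2 m_odd]; move: S cS; rewrite n2 => S.
exact: contaminating_card2.
Qed.
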